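(* Let $r\geq 3$ be an integer and let $G$ be an $r$-graph with edge set $E$. (a) If $r$ is even and $r\geq 4$, then for every positive integer $k$, $G$ has $k$ 1-factors $M_1,\ldots,M_k$ such that $$\frac{|\bigcup_{i=1}^k M_i|}{|E|}\geq 1-\prod_{i=1}^k \frac{(r^2-3r+1)i-(r^2-5r+3)}{(r^2-2r-1)i-(r^2-4r-1)}$$ and $\sum_{i=1}^k |M_i\cap C|\leq (r-1)k+2$ for every edge cut $C$ of $G$ with $|C|=r+1$. (b) If $r$ is odd and $r\geq 3$, then for every positive integer $k$, $G$ has $k$ 1-factors $M_1,\ldots,M_k$ such that $$\frac{|\bigcup_{i=1}^k M_i|}{|E|}\geq 1-\prod_{i=1}^k \frac{(r^2-2r-1)i-(r^2-4r+1)}{(r^2-r-2)i-(r^2-3r-2)},$$ $\sum_{i=1}^k |M_i\cap C|=k$ for every edge cut $C$ of $G$ with $|C|=r$, and $\sum_{i=1}^k |M_i\cap D|\leq rk+2$ for every edge cut $D$ of $G$ with $|D|=r+2$.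
   Context: For a graph $G$ and $S\subseteq V(G)$, $\partial S$ denotes the set of edges of $G$ with exactly one end in $S$; an edge cut is a set of the form $\partial S$. For a positive integer $r$, an $r$-graph is an $r$-regular graph $G$ such that $|\partial S|\geq r$ for every $S\subseteq V(G)$ of odd cardinality. A 1-factor is a perfect matching. The 1-factors $M_1,\ldots,M_k$ need not be distinct. *)

(* Defs.v *)
From mathcomp Require Import all_boot all_order all_algebra.

Set Implicit Arguments.
Unset Strict Implicit.
Unset Printing Implicit Defensive.

(* Finite graphs with a nonempty vertex set; parallel edges are allowed, as   *)
(* is usual for r-graphs. Nothing is lost by excluding loops: a loop at v     *)
(* counts twice in the degree of v and never lies in the cut of [set v], so   *)
(* an r-regular graph with a loop at v has |cut [set v]| <= r - 2 and is      *)
(* not an r-graph.                                                            *)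
Record multigraph := Multigraph {
  vertex : finType;
  edge : finType;
  ends : edge -> {set vertex};
  card_ends : forall e, #|ends e| = 2;
  vertex_nonempty : 0 < #|vertex|
}.

Section Graph.
Variable G : multigraph.

Definition regular (r : nat) : Prop :=
  forall v : vertex G, #|[set e : edge G | v \in ends e]| = r.

Definition cut (S : {set vertex G}) : {set edge G} :=
  [set e | #|ends e :&: S| == 1].

Definition edge_cut (C : {set edge G}) : Prop :=
  exists S : {set vertex G}, C = cut S.

Definition r_graph (r : nat) : Prop :=
  regular r /\ forall S : {set vertex G}, odd #|S| -> r <= #|cut S|.

Definition one_factor (M : {set edge G}) : Prop :=
  forall v : vertex G, #|[set e in M | v \in ends e]| = 1.

End Graph.

(* Main.v *)
Require Import Defs.
From mathcomp Require Import all_boot all_order all_algebra.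
From mathcomp Require Import ring lra zify.

Set Implicit Arguments.
Unset Strict Implicit.
Unset Printing Implicit Defensive.

Import Order.TTheory GRing.Theory Num.Theory.

Local Open Scope ring_scope.

(* The 1-factors are chosen one at a time. Put A = a k + b, with a = r - 2,   *)
(* b = 2 for even r and a = (r - 1) / 2, b = 1 for odd r, and let n(e) be the *)
(* number of the first k 1-factors through e. The choice keeps the weights    *)
(* w(e) = (A - n(e)) / (r A - k) in the perfect matching polytope, and w is a *)
(* convex combination of 1-factors by Edmonds' theorem; some 1-factor in that *)
(* combination covers at least a fraction A / (r A - k) of the uncovered      *)
(* edges, and it meets every odd cut of weight 1 exactly once. By parity a    *)
(* cut whose inequality is not tight has a slack of 2 in the integral form of *)
(* the inequality, so the weights of step k + 1 lie in the polytope again.    *)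
(*                                                                            *)
(* Edmonds' theorem is proved by induction on the number of vertices plus the *)
(* number of edges of positive weight. A tight odd cut that is not a star is  *)
(* contracted on either side and the two combinations are glued along the     *)
(* cut. Otherwise one moves in both directions along a vector with zero star  *)
(* sums until an edge vanishes or a cut becomes tight; w lies in between.     *)

(** For an odd vertex set whose cut has size r + 2q, the cut inequality for the weights of step k,
    cleared of denominators, says that the first k 1-factors use the cut at most 2q(ak + b) + k
    times. This invariant, [balanced], yields the cut bounds: q = 0 gives at most k uses, hence
    exactly k because a 1-factor meets every cut of an odd set; q = 1 gives (2a + 1)k + 2b, which is
    rk + 2 for odd r. For even r all cuts are even, so none has size r + 1. [balanced_cons]
    preserves the invariant, and [exists_covering_factors] iterates it, shrinking the uncovered part
    by a factor of at most 1 - A / (rA - k) at each step.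

    Each new 1-factor comes from [exists_perfect_tight], an averaging over the combination given by
    [fractional_factor_combination]. The latter rests on [combination_glue] at tight cuts, and
    otherwise on [exists_direction] and [move_to_boundary]. *)

Section EdgeCuts.
Variables (V E : finType) (t h : E -> V).

(** Exclusive or keeps loops out of every cut; contraction will create loops. *)
Definition ecut (S : {set V}) : {set E} :=
  [set e | (t e \in S) (+) (h e \in S)].

Definition perfect (M : {set E}) : Prop :=
  forall v, #|M :&: ecut [set v]| = 1%N.

Lemma ecut1E e v : (e \in ecut [set v]) = (t e == v) (+) (h e == v).
Proof. by rewrite !inE. Qed.

Lemma ecutC S : ecut (~: S) = ecut S.
Proof. by apply/setP=> e; rewrite !inE; do 2!case: (_ \in S). Qed.

Lemma sum_ecut1 (R : nmodType) (g : E -> R) :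
  (forall e, t e = h e -> g e = 0) ->
  \sum_v \sum_(e in ecut [set v]) g e = (\sum_e g e) *+ 2.
Proof.
move=> g0; rewrite (exchange_big_dep xpredT) //= -sumrMnl.
apply: eq_bigr => e _.
case: (eqVneq (t e) (h e)) => [/g0 ->|the]; first by rewrite mul0rn big1.
rewrite (eq_bigl (mem [set t e; h e])) ?sumr_const ?cards2 ?the // => v.
rewrite ecut1E inE /= !inE ![v == _]eq_sym; move: the.
by case: (t e =P v) => [->|//]; case: (h e =P v) => // ->; rewrite eqxx.
Qed.

Lemma odd_sum (I : finType) (P : pred I) (F : I -> nat) :
  odd (\sum_(i | P i) F i)%N = \big[addb/false]_(i | P i) odd (F i).
Proof. exact: (big_morph odd oddD). Qed.

Lemma sum_in_setI (A B : {set E}) :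
  #|A :&: B| = (\sum_(e in A) (e \in B))%N.
Proof.
rewrite -sum1_card [RHS]big_mkcond [LHS]big_mkcond /=; apply: eq_bigr => e _.
by rewrite inE; case: (e \in A); case: (e \in B).
Qed.

(** Modulo 2 the cut of [S] is the sum of the stars of its vertices: an edge inside [S] is counted
    twice. *)
Lemma odd_ecut (F : {set E}) S :
  odd #|F :&: ecut S| = odd (\sum_(v in S) #|F :&: ecut [set v]|)%N.
Proof.
have mem x : \big[addb/false]_(v in S) (x == v) = (x \in S).
  case: (boolP (x \in S)) => xS.
    rewrite (bigD1 x) //= eqxx big1 // => v /andP[_].
    by rewrite eq_sym; apply: negbTE.
  rewrite big1 // => v vS; apply: contraNF xS => /eqP -> //.
rewrite sum_in_setI !odd_sum.
under [RHS]eq_bigr => v _ do rewrite sum_in_setI odd_sum.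
rewrite exchange_big /=; apply: eq_bigr => e _.
under [RHS]eq_bigr => v _ do rewrite oddb ecut1E.
by rewrite big_split /= !mem inE oddb.
Qed.

Lemma odd_perfect M S : perfect M -> odd #|M :&: ecut S| = odd #|S|.
Proof.
by move=> pM; rewrite odd_ecut (eq_bigr (fun=> 1%N)) ?sum1_card.
Qed.

End EdgeCuts.

(** * Fractional 1-factors and gluing along a tight cut *)

Section Polytope.
Variable R : realFieldType.

Section Gluing.
Variables (V E : finType) (t h : E -> V).

(** Edmonds' inequalities. Loops lie in no cut, so only the second clause bounds their weight from
    above. *)
Definition fractional_factor (w : E -> R) : Prop :=
  [/\ forall e, 0 <= w e,
      forall e, t e = h e -> w e = 0,
      forall v, \sum_(e in ecut t h [set v]) w e = 1
    & forall S : {set V}, odd #|S| -> 1 <= \sum_(e in ecut t h S) w e].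

(* No normalisation is required: for [P := perfect t h] the coefficients sum  *)
(* to the weight of any star.                                                 *)
Definition combination (P : {set E} -> Prop) (w : E -> R) : Prop :=
  exists (I : finType) (lam : I -> R) (M : I -> {set E}),
    [/\ forall i, 0 <= lam i, forall i, 0 < lam i -> P (M i)
      & forall e, w e = \sum_(i | e \in M i) lam i].

Lemma combination_mono (P Q : {set E} -> Prop) w :
  (forall M, P M -> Q M) -> combination P w -> combination Q w.
Proof.
move=> PQ [I [lam [M [l0 lP lE]]]]; exists I, lam, M.
by split=> // i /lP /PQ.
Qed.

Lemma combinationD P (w w1 w2 : E -> R) (a b : R) :
  0 <= a -> 0 <= b -> combination P w1 -> combination P w2 ->
  (forall e, w e = a * w1 e + b * w2 e) -> combination P w.
Proof.
move=> a0 b0 [I [lam [M [l0 lP lE]]]] [J [mu [N [m0 mP mE]]]] wE.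
pose nu x := match x with inl i => a * lam i | inr j => b * mu j end.
pose L x := match x with inl i => M i | inr j => N j end.
exists (I + J)%type, nu, L; split.
- by case=> i /=; apply: mulr_ge0.
- have pos c x : 0 <= x -> 0 < c * x -> 0 < x :> R.
    by rewrite le0r => /predU1P[->|//]; rewrite mulr0.
  by case=> i /= /pos p; [apply/lP/p | apply/mP/p].
move=> e; rewrite big_sumType /= -!mulr_sumr -lE -mE; exact: wE.
Qed.

Lemma combination_integral w :
  fractional_factor w -> (forall e, w e = 0 \/ w e = 1) ->
  combination (perfect t h) w.
Proof.
move=> [w0 wl w1 _] wI; pose M := [set e | w e == 1].
have wM e : w e = (e \in M)%:R.
  by rewrite inE; case: (wI e) => ->; rewrite ?eqxx // eq_sym oner_eq0.
exists unit, (fun=> 1), (fun=> M); split=> // [_ _ v|e].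
  apply/eqP; rewrite -(eqr_nat R) setIC sum_in_setI natr_sum; apply/eqP.
  by rewrite -[RHS](w1 v); apply: eq_bigr => e _; rewrite -wM.
rewrite wM; case: (e \in M); last by rewrite big_pred0.
by rewrite (big_pred1 tt) // => -[].
Qed.

(* 1-factors and weights of the graph in which [U] is shrunk to one vertex,   *)
(* expressed in the original graph.                                           *)
Definition factor_mod (U : {set V}) (M : {set E}) : Prop :=
  #|M :&: ecut t h U| = 1%N /\
  forall v, v \notin U -> #|M :&: ecut t h [set v]| = 1%N.

Definition weight_mod (U : {set V}) (w : E -> R) (e : E) : R :=
  if (t e \in U) && (h e \in U) then 0 else w e.

Lemma pos_of_mem (I : finType) (lam : I -> R) (M : I -> {set E}) (w : E -> R) :
  (forall i, 0 <= lam i) -> (forall e, w e = \sum_(i | e \in M i) lam i) ->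
  forall i e, 0 < lam i -> e \in M i -> 0 < w e.
Proof.
move=> l0 lE i e li eM; rewrite lE (bigD1 i) //= ltr_wpDr // sumr_ge0 //.
Qed.

(** A coupling of the two families: draw a cut edge [e] with weight [w e], then independently a
    member of each family through [e]. Members of positive coefficient meet the cut once, so for
    them the sum has at most one term. *)
Definition glue_weight (w : E -> R) (C : {set E}) (I J : finType)
    (lam : I -> R) (M : I -> {set E}) (mu : J -> R) (N : J -> {set E}) i j : R :=
  \sum_(e in C | (e \in M i) && (e \in N j)) (lam i * mu j / w e).

Section Glue.
Variables (w : E -> R) (U : {set V}) (I J : finType).
Variables (lam : I -> R) (M : I -> {set E}) (mu : J -> R) (N : J -> {set E}).
Let C := ecut t h U.
Hypothesis w_ge0 : forall e, 0 <= w e.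
Hypotheses (lam_ge0 : forall i, 0 <= lam i) (mu_ge0 : forall j, 0 <= mu j).
Hypothesis lamP : forall i, 0 < lam i -> factor_mod U (M i).
Hypothesis muP : forall j, 0 < mu j -> factor_mod (~: U) (N j).
Hypothesis lamE : forall e, weight_mod U w e = \sum_(i | e \in M i) lam i.
Hypothesis muE : forall e, weight_mod (~: U) w e = \sum_(j | e \in N j) mu j.
Let nu := glue_weight w C lam M mu N.

Lemma glue_neq0 i j :
  nu i j != 0 -> [/\ 0 < lam i, 0 < mu j & M i :&: C = N j :&: C].
Proof.
move=> nuN.
have li : 0 < lam i.
  rewrite lt0r lam_ge0 andbT; apply: contra nuN => /eqP l0.
  by rewrite /nu /glue_weight big1 // => e _; rewrite l0 !mul0r.
have mj : 0 < mu j.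
  rewrite lt0r mu_ge0 andbT; apply: contra nuN => /eqP l0.
  by rewrite /nu /glue_weight big1 // => e _; rewrite l0 mulr0 mul0r.
split=> //.
have [e /and3P[eC eM eN]] : exists e, [&& e \in C, e \in M i & e \in N j].
  apply/existsP; apply: contraNT nuN => /existsPn no.
  by rewrite /nu /glue_weight big1 // => e; rewrite (negPf (no e)).
have [/eqP/cards1P[x Mx] _] := lamP li.
have [/eqP/cards1P[y]] := muP mj; rewrite ecutC => Ny _.
have : e \in M i :&: C by rewrite inE eM.
have : e \in N j :&: C by rewrite inE eN.
by rewrite Mx Ny !inE => /eqP <- /eqP <-.
Qed.

(** The shrunken weight vanishes on edges inside the complement of [U], so an edge of [N j] that is
    not inside [U] lies in the cut, where [M i] and [N j] agree. *)
Lemma glue_right_outside i j e :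
  nu i j != 0 -> e \in N j -> ~~ ((t e \in U) && (h e \in U)) -> e \in M i.
Proof.
move=> /glue_neq0[li mj MN] eN eU.
have eC : e \in C.
  have := pos_of_mem mu_ge0 muE mj eN.
  rewrite /weight_mod /C !inE; case: ifP; rewrite ?ltxx // => + _.
  by move: eU; do 2!case: (_ \in U).
by have : e \in M i :&: C; [rewrite MN inE eN | rewrite inE => /andP[]].
Qed.

Lemma glue_factor i j v :
  nu i j != 0 -> v \notin U ->
  #|(M i :|: N j) :&: ecut t h [set v]| = 1%N.
Proof.
move=> nuN vU; have [li mj MN] := glue_neq0 nuN.
rewrite -((lamP li).2 v vU); congr #|pred_of_set _|.
apply/setP => e; rewrite !inE; case: (boolP (e \in M i)) => //= eM.
case: (boolP (e \in N j)) => //= eN; apply: contraNF eM => tv.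
apply: (glue_right_outside nuN) => //; apply: contra vU => /andP[tU hU].
by move: tv; case: eqP => [<-|_] //=; case: eqP => [<-|].
Qed.

(** Summing out [j] returns [lam i]: if [f] is the cut edge of [M i], the coefficients [mu j] with
    [f] in [N j] add up to [w f], which cancels the denominator. *)
Lemma glue_marginal e : ~~ ((t e \in U) && (h e \in U)) ->
  w e = \sum_i \sum_(j | e \in M i :|: N j) nu i j.
Proof.
move=> eU.
have -> : w e = \sum_(i | e \in M i) lam i.
  by rewrite -lamE /weight_mod (negPf eU).
rewrite big_mkcond /=; apply: eq_bigr => i _.
rewrite (eq_bigl (fun j => (nu i j != 0) && (e \in M i)
    || (nu i j == 0) && (e \in M i :|: N j))); last first.
  move=> j; rewrite inE; case: eqVneq => [|nuN] //=.
  rewrite orbF; case: (boolP (e \in M i)) => //= eM.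
  by apply: contraNF eM => eN; apply: (glue_right_outside nuN).
transitivity (\sum_(j | e \in M i) nu i j); last first.
  rewrite big_mkcond [RHS]big_mkcond; apply: eq_bigr => j _ /=.
  by rewrite inE; case: (nu i j =P 0) => [->|_] /=; rewrite ?orbF ?if_same.
case: ifP => eM; last by rewrite big_pred0.
rewrite /nu /glue_weight; case: (ltrP 0 (lam i)) => [li|]; last first.
  move=> li; have -> : lam i = 0 by apply/le_anti; rewrite li lam_ge0.
  by rewrite big1 // => j _; rewrite big1 // => f _; rewrite !mul0r.
rewrite (exchange_big_dep (fun f => f \in M i :&: C)) /=; last first.
  by move=> j f _ /andP[fC /andP[fM _]]; rewrite inE fM.
rewrite (eq_bigr (fun=> lam i)).
  by rewrite sumr_const (lamP li).1.
move=> f; rewrite inE => /andP[fM fC].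
have wf : 0 < w f.
  have := pos_of_mem lam_ge0 lamE li fM; rewrite /weight_mod.
  by case: ifP; rewrite ?ltxx.
under eq_bigl => j do rewrite fC fM /=.
rewrite -mulr_suml -mulr_sumr -muE /weight_mod ifF ?mulfK ?gt_eqF //.
by move: fC; rewrite /C !inE; do 2!case: (_ \in U).
Qed.

End Glue.

Lemma combination_glue w U :
  (forall e, 0 <= w e) ->
  combination (factor_mod U) (weight_mod U w) ->
  combination (factor_mod (~: U)) (weight_mod (~: U) w) ->
  combination (perfect t h) w.
Proof.
move=> w0 [I [lam [M [l0 lP lE]]]] [J [mu [N [m0 mP mE]]]].
have lP' i : 0 < lam i -> factor_mod (~: ~: U) (M i) by rewrite setCK; apply: lP.
have lE' e : weight_mod (~: ~: U) w e = \sum_(i | e \in M i) lam i.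
  by rewrite setCK.
pose C := ecut t h U; pose nu i j := glue_weight w C lam M mu N i j.
(* The coupling is symmetric, so vertices and edges inside [U] are handled by the same lemmas with
   [U] and its complement exchanged. *)
have nuC i j : nu i j = glue_weight w (ecut t h (~: U)) mu N lam M j i.
  rewrite /nu /glue_weight ecutC; apply: eq_big => e.
    by rewrite [(e \in N j) && _]andbC.
  by rewrite [mu j * _]mulrC.
exists (I * J)%type, (fun x => nu x.1 x.2), (fun x => M x.1 :|: N x.2); split.
- case=> i j; apply: sumr_ge0 => e _.
  by apply: divr_ge0 => //; apply: mulr_ge0.
- case=> i j /= nu0 v; have nuN : nu i j != 0 by rewrite gt_eqF.
  case: (boolP (v \in U)) => vU; last exact: (glue_factor l0 m0 lP mP mE).
  rewrite setUC; rewrite nuC in nuN; apply: (glue_factor m0 l0 mP lP' lE' nuN).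
  by rewrite inE negbK.
move=> e; rewrite -(pair_big_dep xpredT (fun i j => e \in M i :|: N j) nu) /=.
case: (boolP ((t e \in U) && (h e \in U))) => eU; last exact: glue_marginal.
rewrite (exchange_big_dep xpredT) //=.
rewrite (@glue_marginal w (~: U) J I mu N lam M) //; last first.
  by case/andP: eU; rewrite !inE => ->.
by apply: eq_bigr => j _; apply: eq_big => i; rewrite 1?setUC 1?nuC.
Qed.

End Gluing.
End Polytope.

(** * Contracting an odd set *)

Section Contraction.
Variables (R : realFieldType) (V E : finType) (t h : E -> V) (U : {set V}).

(** [None] is the vertex that [U] becomes. The edge type is kept, and edges inside [U] turn into
    loops. *)
Definition contract (v : V) : option {v | v \notin U} := insub v.

Lemma ecut_contract S :
  ecut (contract \o t) (contract \o h) S = ecut t h (contract @^-1: S).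
Proof. by apply/setP => e; rewrite !inE. Qed.

Lemma contract_eqN v : (contract v == None) = (v \in U).
Proof.
rewrite /contract; case: insubP => [x vU _|]; first by rewrite (negPf vU).
by rewrite negbK => ->.
Qed.

Lemma contract_None : contract @^-1: [set None] = U.
Proof. by apply/setP => v; rewrite !inE contract_eqN. Qed.

Lemma contract_Some x : contract @^-1: [set Some x] = [set val x].
Proof.
apply/setP => v; rewrite !inE /contract; case: insubP => [y vU <-|].
  by rewrite (inj_eq Some_inj) val_eqE.
by rewrite negbK => vU; apply/esym/negP => /eqP vx; move: (valP x); rewrite -vx vU.
Qed.

(** The fibre over [None] is [U], which is odd, and all other fibres are singletons. *)
Lemma odd_contract (S : {set option {v | v \notin U}}) :
  odd #|U| -> odd #|contract @^-1: S| = odd #|S|.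
Proof.
move=> oU; rewrite -!sum1_card (partition_big contract (mem S)) /=; last first.
  by move=> v; rewrite inE.
rewrite !odd_sum; apply: eq_bigr => x xS.
rewrite (eq_bigl (mem (contract @^-1: [set x]))); last first.
  by move=> v; rewrite !inE; case: eqP => [->|]; rewrite ?xS ?andbF.
rewrite sum1_card.
by case: x xS => [x|] _; rewrite ?contract_None ?contract_Some ?cards1.
Qed.

Lemma sum_weight_mod (w : E -> R) S :
  \sum_(e in ecut (contract \o t) (contract \o h) S) weight_mod t h U w e
  = \sum_(e in ecut t h (contract @^-1: S)) w e.
Proof.
rewrite ecut_contract; apply: eq_bigr => e.
rewrite /weight_mod; case: ifP => // /andP[].
by rewrite -!contract_eqN !inE => /eqP -> /eqP ->; rewrite addbb.
Qed.

Lemma fractional_contract (w : E -> R) :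
  fractional_factor t h w -> odd #|U| -> \sum_(e in ecut t h U) w e = 1 ->
  fractional_factor (contract \o t) (contract \o h) (weight_mod t h U w).
Proof.
move=> [w0 wl w1 wS] oU tU; split=> [e|e|x|S oS].
- by rewrite /weight_mod; case: ifP.
- rewrite /weight_mod /= => /eqP; case: ifP => // /negbT tUh.
  rewrite /contract; case: insubP => [x _ xt|/negPn teU];
    case: insubP => [y _ yh|/negPn heU] //.
    by move=> /eqP[xy]; apply: wl; rewrite -xt -yh xy.
  by move: tUh; rewrite teU heU.
- rewrite sum_weight_mod; case: x => [x|]; first by rewrite contract_Some.
  by rewrite contract_None.
by rewrite sum_weight_mod wS // odd_contract.
Qed.

Lemma perfect_contract M :
  perfect (contract \o t) (contract \o h) M -> factor_mod t h U M.
Proof.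
move=> pM; split; first by have := pM None; rewrite ecut_contract contract_None.
by move=> v vU; have := pM (Some (exist _ v vU)); rewrite ecut_contract contract_Some.
Qed.

Lemma card_contract : #|{: option {v | v \notin U}}| = #|~: U|.+1.
Proof.
rewrite card_option card_sig; congr _.+1; apply: eq_card => v.
by rewrite !inE.
Qed.

End Contraction.

(** * Moving inside the polytope *)

(** In the matrix with rows [F] and columns [W], dependent rows give a kernel vector; independent
    rows force it to be square and invertible, and the rows of its inverse are the dual vectors. *)
Lemma kernel_or_dual (R : fieldType) (V E : finType) (F : {set E}) (W : {set V})
    (a : E -> V -> R) :
  (#|W| <= #|F|)%N ->
  (exists d : E -> R, [/\ exists e, d e != 0, forall e, e \notin F -> d e = 0
      & forall v, v \in W -> \sum_(e in F) d e * a e v = 0])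
  \/ (#|F| = #|W| /\ forall v0, v0 \in W -> exists d : E -> R,
       forall v, v \in W -> \sum_(e in F) d e * a e v = (v == v0)%:R).
Proof.
move=> WF; pose A : 'M[R]_(#|F|, #|W|) :=
  \matrix_(i, j) a (enum_val i) (enum_val j).
pose lift_row (u : 'rV[R]_#|F|) e := \sum_i u 0 i * (e == enum_val i)%:R.
have lift_val u i : lift_row u (enum_val i) = u 0 i.
  rewrite /lift_row (bigD1 i) //= eqxx mulr1 big1 ?addr0 // => j ji.
  by rewrite (inj_eq enum_val_inj) eq_sym (negPf ji) mulr0.
have lift_out u e : e \notin F -> lift_row u e = 0.
  move=> eF; rewrite /lift_row big1 // => i _; case: eqP => [ei|]; rewrite ?mulr0 //.
  by move: eF; rewrite ei enum_valP.
have lift_sum u (j : 'I_#|W|) :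
    \sum_(e in F) lift_row u e * a e (enum_val j) = (u *m A) 0 j.
  rewrite big_enum_val mxE; apply: eq_bigr => i _ /=.
  by rewrite lift_val mxE.
case: (boolP (row_free A)) => [fA|].
  right; have rA : #|F| = #|W|.
    by apply/eqP; rewrite eqn_leq WF andbT -(eqP fA) rank_leq_col.
  split=> // v0 v0W.
  have /row_fullP[D DA] : row_full A by rewrite /row_full (eqP fA) rA.
  exists (lift_row (row (enum_rank_in v0W v0) D)) => v vW.
  rewrite -{1}(enum_rankK_in v0W vW) lift_sum -row_mul DA row1 mxE eqxx /=.
  by rewrite (inj_in_eq (can_in_inj (enum_rankK_in v0W))).
rewrite -kermx_eq0 => /rowV0Pn[u /sub_kermxP uA u0]; left.
exists (lift_row u); split; first 1 last.
- exact: lift_out.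
- by move=> v vW; rewrite -(enum_rankK_in vW vW) lift_sum uA mxE.
by have /rV0Pn[i ui] := u0; exists (enum_val i); rewrite lift_val.
Qed.

Lemma first_vanishing (R : realFieldType) (J : finType) (a b : J -> R) :
  (forall j, 0 <= a j) -> (forall j, b j < 0 -> 0 < a j) ->
  (exists j, b j < 0) ->
  exists eps, [/\ 0 < eps, forall j, 0 <= a j + eps * b j
    & exists j, b j < 0 /\ a j + eps * b j = 0].
Proof.
move=> a0 ab [j0 bj0].
case: (@arg_minP _ _ J j0 (fun j => b j < 0) (fun j => a j / - b j) bj0) => j bj jmin.
exists (a j / - b j); split.
- by rewrite divr_gt0 ?ab ?oppr_gt0.
- move=> i; case: (ltrP (b i) 0) => bi.
    have := jmin i bi; rewrite ler_pdivlMr ?oppr_gt0 // mulrN.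
    by rewrite -subr_ge0 opprK addrC.
  by rewrite addr_ge0 // mulr_ge0 // divr_ge0 // oppr_ge0 ltW.
by exists j; split=> //; field; rewrite lt_eqF.
Qed.

Section Direction.
Variables (R : realFieldType) (V E : finType) (t h : E -> V) (w : E -> R).
Hypothesis wP : fractional_factor t h w.
Let F : {set E} := [set e | 0 < w e < 1].
Let W : {set V} := [set v | [exists e in F, e \in ecut t h [set v]]].

Lemma nonloop_pos e : w e != 0 -> t e != h e.
Proof. by case: wP => _ wl _ _; apply: contra => /eqP /wl ->. Qed.

Lemma weight_le1 e : w e <= 1.
Proof.
case: wP => w0 wl w1 _; case: (eqVneq (w e) 0) => [->|/nonloop_pos the] //.
rewrite -(w1 (t e)) (bigD1 e) ?ecut1E ?eqxx 1?eq_sym ?(negPf the) //=.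
by rewrite lerDl sumr_ge0.
Qed.

Lemma fractional_closed v e :
  v \in W -> e \in ecut t h [set v] -> 0 < w e -> e \in F.
Proof.
case: wP => w0 wl w1 _; rewrite !inE -ecut1E.
case/exists_inP => f; rewrite inE => /andP[f0 f1] fv ev e0; rewrite e0 /=.
case: (eqVneq e f) => [->//|ef].
have := w1 v; rewrite (bigD1 f) // (bigD1 e) /=; last by rewrite ev ef.
set s := bigop.body _ _ _; have : 0 <= s by apply: sumr_ge0.
lra.
Qed.

(** The weights at [v] sum to 1 and one fractional weight falls short of it, so a second edge has
    positive weight. *)
Lemma card_fractional_at v : v \in W -> (1 < #|F :&: ecut t h [set v]|)%N.
Proof.
case: wP => w0 wl w1 _ vW; have := vW; rewrite inE => /exists_inP[f fF fv].
apply/card_gt1P.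
have [e /andP[ev ef] e0] : exists2 e, (e \in ecut t h [set v]) && (e != f) & 0 < w e.
  apply/exists_inP; move: fF; rewrite inE => /andP[_]; apply: contraTT.
  move=> /exists_inPn no; rewrite -leNgt -(w1 v) (bigD1 f) //= big1 ?addr0 //.
  by move=> e /no; rewrite -leNgt => we; apply/le_anti; rewrite we w0.
exists f, e; split; rewrite ?inE ?fF ?fv ?ev /= ?andbT //.
- by move: fF fv; rewrite !inE => -> ->.
- by have := fractional_closed vW ev e0; move: ev; rewrite !inE => -> ->.
by rewrite eq_sym.
Qed.

Lemma handshake_fractional (T : {set E}) :
  T \subset F -> (\sum_(v in W) #|T :&: ecut t h [set v]| = #|T|.*2)%N.
Proof.
move=> /subsetP TF.
have g0 e : t e = h e -> (e \in T : nat) = 0%R.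
  case: (boolP (e \in T)) => // /TF.
  by rewrite inE => /andP[/lt0r_neq0/nonloop_pos/eqP].
have -> : #|T| = (\sum_e (e \in T))%N by rewrite -sum1_card big_mkcond.
rewrite -addnn.
transitivity (\sum_v \sum_(e in ecut t h [set v]) (e \in T))%N; last first.
  exact: (etrans (sum_ecut1 g0) (mulr2n _)).
rewrite [RHS](bigID (mem W)) /= [X in (_ + X)%N]big1 ?addn0.
  by apply: eq_bigr => v _; rewrite setIC sum_in_setI.
move=> v vW; apply: big1 => e ev; case: (boolP (e \in T)) => // /TF eF.
by case/negP: vW; rewrite inE; apply/exists_inP; exists e.
Qed.

Lemma card_fractional_ge : (#|W| <= #|F|)%N.
Proof.
have := handshake_fractional (subxx F).
suff : (#|W|.*2 <= \sum_(v in W) #|F :&: ecut t h [set v]|)%N by lia.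
rewrite -muln2 -sum_nat_const; apply: leq_sum => v; exact: card_fractional_at.
Qed.

Lemma card_fractional_at2 v :
  #|F| = #|W| -> v \in W -> #|F :&: ecut t h [set v]| = 2.
Proof.
move=> FW vW; have := handshake_fractional (subxx F).
rewrite FW -muln2 -sum_nat_const => sE.
have s0 : (\sum_(v in W) (#|F :&: ecut t h [set v]| - 2) == 0)%N.
  by rewrite sumnB ?sE ?subnn // => u; exact: card_fractional_at.
have := card_fractional_at vW; move: s0; rewrite sum_nat_eq0 => /forall_inP /(_ v vW).
by rewrite subn_eq0 => a b; apply/eqP; rewrite eqn_leq a b.
Qed.

(* If the fractional edges form a 2-regular graph and [d] has star sums       *)
(* [v == v0], then [|d|] is constant at each vertex (at [v0] by parity), so   *)
(* it is 1/2 on an odd vertex set that no fractional edge leaves.             *)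
Lemma no_unit_potential v0 (d : E -> R) :
  #|F| = #|W| -> v0 \in W ->
  ~ (forall v, v \in W ->
       \sum_(e in F :&: ecut t h [set v]) d e = (v == v0)%:R).
Proof.
move=> FW v0W dP.
pose T (x : R) := [set e in F | `|d e| == x].
have TF x : T x \subset F by apply/subsetP => e; rewrite inE => /andP[].
have pair v : v \in W -> exists e f,
    [/\ e != f, F :&: ecut t h [set v] = [set e; f] & d e + d f = (v == v0)%:R].
  move=> vW; have /eqP/cards2P[e [f [ef Fv]]] := card_fractional_at2 FW vW.
  by exists e, f; split=> //; rewrite -dP // Fv big_setU1 ?inE //= big_set1.
have Tat x v : T x :&: ecut t h [set v] =
    [set e in F :&: ecut t h [set v] | `|d e| == x].
  by apply/setP => e; rewrite !inE; case: (`|d e| == x); rewrite ?andbT ?andbF.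
have Tev x v : v \in W -> v != v0 ->
    T x :&: ecut t h [set v] = set0 \/
    T x :&: ecut t h [set v] = F :&: ecut t h [set v].
  move=> vW vv0; rewrite Tat; have [e [f [ef -> ]]] := pair v vW.
  rewrite (negPf vv0) => /eqP; rewrite addr_eq0 => /eqP def.
  have nef : `|d e| = `|d f| by rewrite def normrN.
  case: (eqVneq `|d f| x) => fx; [right|left]; apply/setP => g; rewrite !inE.
    by case: eqP => [->|_]; [rewrite nef fx eqxx |
      case: eqP => [->|//]; rewrite fx eqxx].
  apply/negP => /andP[/orP[]/eqP->]; by rewrite ?nef (negPf fx).
(* [T x] has degree 0 or 2 at every vertex of [W] other than [v0], so by the handshake its degree at
   [v0] is even. *)
have Todd x : ~~ odd #|T x :&: ecut t h [set v0]|.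
  have := congr1 odd (handshake_fractional (TF x)).
  rewrite odd_double (bigD1 v0) //= oddD odd_sum big1 ?addbF => [->//|v /andP[vW vv0]].
  case: (Tev x v vW vv0) => ->; first by rewrite cards0.
  by rewrite card_fractional_at2.
have half e f : e != f -> F :&: ecut t h [set v0] = [set e; f] -> d e + d f = 1 ->
    d e != 0 -> `|d e| = `|d f|.
  move=> ef Fv def de; have := Todd `|d e|; rewrite Tat Fv.
  case: (eqVneq `|d e| `|d f|) => // nef.
  rewrite (_ : [set _ in _ | _] = [set e]) ?cards1 //.
  apply/setP => g; rewrite !inE; case: (eqVneq g e) => [->|ge] /=; rewrite ?eqxx //.
  by case: eqP => // ->; rewrite eq_sym (negPf nef).
have [e0 [f0 [ef0 Fv0 def0]]] := pair v0 v0W; rewrite eqxx mulr1n in def0.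
have nef0 : `|d e0| = `|d f0|.
  case: (eqVneq (d e0) 0) => de0; last exact: half.
  apply/esym/half; rewrite 1?setUC 1?addrC //; first by rewrite eq_sym.
  by move: def0; rewrite de0 add0r => ->; apply: oner_neq0.
have [de0 df0] : d e0 = 1/2 /\ d f0 = 1/2.
  have : d e0 = d f0.
    move/eqP: nef0; rewrite eqr_norm2 => /orP[]/eqP // dN.
    by move/eqP: def0; rewrite dN addNr eq_sym oner_eq0.
  by move=> dE; move: def0; rewrite dE; split; lra.
have half_norm : `|1/2 : R| = 1/2 by rewrite ger0_norm //; lra.
pose H := T (1/2).
have HF : H \subset F := TF _.
have Hat v : v \in W -> H :&: ecut t h [set v] = set0 \/
    H :&: ecut t h [set v] = F :&: ecut t h [set v].
  move=> vW; case: (eqVneq v v0) => [->|]; last exact: Tev.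
  right; rewrite /H Tat Fv0; apply/setP => g; rewrite !inE.
  by case: eqP => [->|_]; [rewrite de0 | case: eqP => [->|//]; rewrite df0];
    rewrite half_norm eqxx.
(* At each vertex [H] has all or none of the two fractional edges, so it is 2-regular on [S]. *)
pose S := [set v in W | H :&: ecut t h [set v] != set0].
have cardS : #|S| = #|H|.
  have := handshake_fractional HF; rewrite (bigID (mem S)) /= [X in (_ + X)%N]big1.
    rewrite addn0 (eq_bigl (fun v => v \in S)); last first.
      by move=> v; apply: andb_idl; rewrite inE => /andP[].
    rewrite (eq_bigr (fun=> 2)) ?sum_nat_const => [|v]; first by lia.
    rewrite inE => /andP[vW] Hv; rewrite -(card_fractional_at2 FW vW).
    by case: (Hat v vW) Hv => ->; rewrite ?eqxx.
  move=> v /andP[vW]; rewrite inE vW negbK => /eqP ->; exact: cards0.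
have sumH : (\sum_(e in H) d e) *+ 2 = 1.
  rewrite big_mkcond /= -(@sum_ecut1 V E t h); last first.
    move=> e the; case: ifP => // /(subsetP HF).
    rewrite inE => /andP[/lt0r_neq0/nonloop_pos].
    by rewrite the eqxx.
  have star v : \sum_(e in ecut t h [set v]) (if e \in H then d e else 0) =
      \sum_(e in H :&: ecut t h [set v]) d e.
    by rewrite -big_mkcondr; apply: eq_bigl => e; rewrite !inE andbC.
  rewrite (bigD1 v0) //= star [X in _ + X]big1 ?addr0 => [|v vv0].
    case: (Hat v0 v0W) => HE; last by rewrite HE dP // eqxx.
    have : e0 \in H :&: ecut t h [set v0].
      have : e0 \in F :&: ecut t h [set v0] by rewrite Fv0 !inE eqxx.
      by move=> e0F; rewrite /H Tat inE e0F de0 half_norm eqxx.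
    by rewrite HE inE.
  rewrite star; case: (boolP (v \in W)) => vW.
    case: (Hat v vW) => HE; rewrite HE ?big_set0 //.
    by rewrite dP // (negPf vv0).
  rewrite big_pred0 // => e; apply: contraNF vW; rewrite !inE -ecut1E.
  case/andP => /andP[eF _] ev; apply/exists_inP; by exists e => //; rewrite inE.
(* On [H] the values are 1/2 and -1/2 with sum 1/2, so the positive ones outnumber the others by
   one. *)
have oddH : odd #|H|.
  pose P := [set e in H | 0 < d e].
  have sP : \sum_(e in H) (d e + 1/2) = #|P|%:R.
    rewrite -sum1_card natr_sum [RHS]big_mkcond [LHS]big_mkcond /=.
    apply: eq_bigr => e _; rewrite /P in_set; case: (boolP (e \in H)) => //=.
    rewrite in_set => /andP[_ /eqP].
    case: (ltrP 0 (d e)) => de; rewrite ?(gtr0_norm de) ?(ler0_norm de); lra.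
  have : (#|H|.+1 = #|P|.*2)%N.
    apply/eqP; rewrite -(eqr_nat R) -mul2n natrM -sP big_split /= sumr_const.
    rewrite -[#|H|.+1]addn1 natrD -[1/2 *+ _]mulr_natr; move: sumH.
    rewrite mulr2n => sumH; apply/eqP; lra.
  lia.
have [w0 _ _ wS] := wP.
have : 1 <= \sum_(e in ecut t h S) w e by apply: wS; rewrite cardS.
(* An edge of positive weight at a vertex of [S] is fractional, hence in [H], so both its ends are
   in [S]: the cut of the odd set [S] would have weight 0. *)
rewrite big1 ?ler10 // => e eS.
have [//|we] := eqVneq (w e) 0.
have we0 : 0 < w e by rewrite lt0r we w0.
have other u v : e \in ecut t h [set u] -> e \in ecut t h [set v] ->
    u \in S -> v \in S.
  move=> eu ev; rewrite inE => /andP[uW Hu].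
  have eF := fractional_closed uW eu we0.
  have eH : e \in H :&: ecut t h [set u].
    by case: (Hat u uW) Hu => HE; rewrite HE ?eqxx // => _; rewrite inE eF.
  rewrite inE; apply/andP; split; first by rewrite inE; apply/exists_inP; exists e.
  by apply/set0Pn; exists e; rewrite inE ev andbT; case/setIP: eH.
have the := nonloop_pos we.
have et : e \in ecut t h [set t e] by rewrite ecut1E eqxx eq_sym (negPf the).
have eh : e \in ecut t h [set h e] by rewrite ecut1E eqxx (negPf the).
move: eS; rewrite inE; have := other _ _ et eh; have := other _ _ eh et.
by case: (t e \in S); case: (h e \in S) => // a b; [have := b isT | have := a isT].
Qed.

(** Fractional edges are at least as many as the vertices they meet. Without a kernel vector
    equality would hold, and a dual vector would contradict [no_unit_potential]. *)
Lemma exists_direction :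
  (exists e, e \in F) ->
  exists d : E -> R, [/\ exists e, d e != 0, forall e, d e != 0 -> 0 < w e
    & forall v, \sum_(e in ecut t h [set v]) d e = 0].
Proof.
move=> [e eF].
pose a e v : R := (e \in ecut t h [set v])%:R.
have aE (d : E -> R) v : \sum_(e in F) d e * a e v =
    \sum_(e in F :&: ecut t h [set v]) d e.
  rewrite big_mkcond [RHS]big_mkcond; apply: eq_bigr => f _ /=; rewrite /a !inE.
  by case: (0 < _ < _) => //=; case: (_ (+) _); rewrite ?mulr1 ?mulr0.
case: (kernel_or_dual a card_fractional_ge) => [[d [dN dF d0]]|[FW dual]].
  exists d; split=> // [f|v].
    by apply: contraNT => f0; rewrite dF // inE (negPf f0).
  case: (boolP (v \in W)) => vW.
    rewrite -[RHS](d0 v vW) aE big_mkcond [RHS]big_mkcond /=.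
    apply: eq_bigr => f _; rewrite in_setI; case: (boolP (f \in F)) => //= fF.
    by case: ifP => // _; apply: dF.
  apply: big1 => f fv; apply: dF; apply: contra vW => fF.
  by rewrite inE; apply/exists_inP; exists f.
have eW : t e \in W.
  rewrite inE; apply/exists_inP; exists e => //; rewrite ecut1E eqxx.
  move: eF; rewrite inE => /andP[/lt0r_neq0/nonloop_pos].
  by rewrite eq_sym => /negPf ->.
have [d dP] := dual _ eW; case: (@no_unit_potential _ d FW eW) => v vW.
by rewrite -dP // aE.
Qed.

(** The ratio test runs over edge weights and slacks of odd cuts together. Cuts with at most one
    vertex on a side do not change along [d]; the other odd cuts have positive slack by
    hypothesis. *)
Lemma move_to_boundary (d : E -> R) :
  (exists e, d e != 0) -> (forall e, d e != 0 -> 0 < w e) ->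
  (forall v, \sum_(e in ecut t h [set v]) d e = 0) ->
  (forall U : {set V}, odd #|U| -> (1 < #|U|)%N -> (1 < #|~: U|)%N ->
    \sum_(e in ecut t h U) w e != 1) ->
  exists eps, [/\ 0 < eps, fractional_factor t h (fun e => w e + eps * d e)
    & (exists e, 0 < w e /\ w e + eps * d e = 0) \/
      (exists U : {set V}, [/\ odd #|U|, (1 < #|U|)%N, (1 < #|~: U|)%N
        & \sum_(e in ecut t h U) (w e + eps * d e) = 1])].
Proof.
move=> dN dw d0 nt; have [w0 wl w1 wS] := wP.
have dl e : t e = h e -> d e = 0.
  by move=> the; apply/eqP; apply: contraTT isT => /dw; rewrite wl ?ltxx.
pose A (x : E + {set V}) : R := match x with inl e => w e
  | inr U => if odd #|U| then \sum_(e in ecut t h U) w e - 1 else 0 end.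
pose B (x : E + {set V}) : R := match x with inl e => d e
  | inr U => if odd #|U| then \sum_(e in ecut t h U) d e else 0 end.
have B_small (S : {set V}) : (#|S| <= 1)%N || (#|~: S| <= 1)%N ->
    \sum_(e in ecut t h S) d e = 0.
  have small (S' : {set V}) : (#|S'| <= 1)%N -> \sum_(e in ecut t h S') d e = 0.
    rewrite leq_eqVlt ltnS leqn0 cards_eq0 => /orP[/cards1P[v ->]|/eqP ->] //.
    by rewrite big_pred0 // => e; rewrite !inE.
  by case/orP => /small //; rewrite ecutC.
have cut_large (S : {set V}) : \sum_(e in ecut t h S) d e < 0 ->
    (1 < #|S|)%N && (1 < #|~: S|)%N.
  apply: contraTT; rewrite negb_and -!leqNgt => /B_small ->; by rewrite ltxx.
have A0 x : 0 <= A x.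
  by case: x => [e|S] /=; [|case: ifP => // oS; rewrite subr_ge0 wS].
have AB x : B x < 0 -> 0 < A x.
  case: x => [e|S] /= b; first by rewrite dw // lt_eqF.
  move: b; case: ifP => [oS /cut_large/andP[S1 S2]|_]; last by rewrite ltxx.
  by rewrite lt0r subr_ge0 wS // subr_eq0 nt.
(* All star sums vanish, so the total of [d] is 0 and a nonzero [d] has a negative entry. *)
have Bneg : exists x, B x < 0.
  apply/existsP; apply: contraT => /existsPn dge.
  have dge0 e : 0 <= d e by have := dge (inl e); rewrite /= -leNgt.
  have := sum_ecut1 dl; rewrite big1 // => /esym/eqP.
  rewrite mulrn_eq0 /= => /eqP /(psumr_eq0P (fun e _ => dge0 e)) dz.
  by case: dN => e; rewrite dz ?eqxx.
have [eps [eps0 ge0 [x [bx ax]]]] := first_vanishing A0 AB Bneg.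
have sumE S : \sum_(e in ecut t h S) (w e + eps * d e) =
    \sum_(e in ecut t h S) w e + eps * \sum_(e in ecut t h S) d e.
  by rewrite big_split mulr_sumr.
exists eps; split=> //.
  split=> [e|e the|v|S oS]; first exact: (ge0 (inl e)).
  - by rewrite wl // dl // mulr0 addr0.
  - by rewrite sumE w1 d0 mulr0 addr0.
  by rewrite sumE; have := ge0 (inr S); rewrite /= oS; lra.
case: x bx ax => [e|S] /=.
  by move=> de we; left; exists e; split; rewrite // dw // lt_eqF.
case: ifP => [oS /cut_large/andP[S1 S2] ax|_]; last by rewrite ltxx.
by right; exists S; split=> //; rewrite sumE; lra.
Qed.

End Direction.

(** * Edmonds' theorem and averaging *)

Section MatchingPolytope.
Variables (R : realFieldType) (E : finType).

Let size_of (V : finType) (w : E -> R) := (#|V| + #|[set e | w e != 0%R]|)%N.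

(** Both contractions lose vertices and gain no edge of positive weight, so the induction hypothesis
    applies to each. *)
Lemma combination_contract (n : nat) (V : finType) (t h : E -> V) (w : E -> R)
    (U : {set V}) :
  (forall (V' : finType) (t' h' : E -> V') (w' : E -> R),
     (size_of V' w' < n)%N -> fractional_factor t' h' w' ->
     combination (perfect t' h') w') ->
  (size_of V w <= n)%N -> fractional_factor t h w ->
  odd #|U| -> (1 < #|U|)%N -> (1 < #|~: U|)%N ->
  \sum_(e in ecut t h U) w e = 1 -> combination (perfect t h) w.
Proof.
move=> IH wn wP oU U1 U2 tU; have [w0 _ w1 wS] := wP.
(* The cut of the full vertex set is empty, so its inequality would fail if the number of vertices
   were odd. *)
have oV : ~~ odd #|V|.
  apply/negP => oV; have := wS setT; rewrite cardsT big_pred0 => [|e].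
    by move=> /(_ oV); rewrite ler10.
  by rewrite !inE.
have oCU : odd #|~: U|.
  by move: oV; rewrite -(cardsC U) oddD oU; case: odd.
have half (X : {set V}) : odd #|X| -> (1 < #|X|)%N ->
    \sum_(e in ecut t h X) w e = 1 ->
    combination (factor_mod t h X) (weight_mod t h X w).
  move=> oX X1 tX; apply: combination_mono (@perfect_contract _ _ t h X) _.
  apply: IH; last exact: fractional_contract.
  apply: leq_trans wn; rewrite /size_of card_contract -(cardsC X) -addSn.
  apply: leq_add; first by rewrite -addn2 addnC leq_add2r.
  apply: subset_leq_card; apply/subsetP => e; rewrite !inE /weight_mod.
  by case: ifP => //; rewrite eqxx.
by apply: (combination_glue w0 (half U _ _ _) (half (~: U) _ _ _)); rewrite ?ecutC.
Qed.

(* Edmonds: the perfect matching polytope is cut out by the star equations    *)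
(* and the odd cut inequalities.                                              *)
Theorem fractional_factor_combination (V : finType) (t h : E -> V) (w : E -> R) :
  fractional_factor t h w -> combination (perfect t h) w.
Proof.
have [n] := ubnP (size_of V w); elim: n V t h w => // n IH V t h w.
rewrite ltnS => wn wP; have [w0 wl w1 wS] := wP.
case: (boolP [exists e, 0 < w e < 1]) => [/existsP[e0 we0]|/existsPn int]; last first.
  apply: (combination_integral wP) => e; have := int e.
  rewrite negb_and -!leNgt => /orP[we|we]; [left|right]; apply/le_anti.
    by rewrite we w0.
  by rewrite we (weight_le1 wP).
case: (boolP [exists U : {set V}, [&& odd #|U|, (1 < #|U|)%N, (1 < #|~: U|)%N
    & \sum_(e in ecut t h U) w e == 1]]) => [/existsP[U /and4P[oU U1 U2 /eqP tU]]|].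
  exact: (combination_contract IH wn wP oU U1 U2 tU).
move=> /existsPn nt.
have [|d [[e1 de1] dw d0]] := exists_direction wP; first by exists e0; rewrite inE.
(* The move ends by losing an edge of the support, which decreases the size, or at a tight cut,
   where contraction applies. *)
have go (d' : E -> R) : d' e1 != 0 -> (forall e, d' e != 0 -> 0 < w e) ->
    (forall v, \sum_(e in ecut t h [set v]) d' e = 0) ->
    exists eps, 0 < eps /\ combination (perfect t h) (fun e => w e + eps * d' e).
  move=> d'1 d'w d'0; have [||eps [eps0 fP end_]] := move_to_boundary wP _ d'w d'0.
  - by exists e1.
  - by move=> U oU U1 U2; have := nt U; rewrite oU U1 U2.
  have sub : [set e | w e + eps * d' e != 0] \subset [set e | w e != 0].
    apply/subsetP => e; rewrite !inE; apply: contra => /eqP we.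
    rewrite we add0r; case: (eqVneq (d' e) 0) => [->|/d'w]; rewrite ?mulr0 //.
    by rewrite we ltxx.
  exists eps; split=> //; case: end_ => [[e [we we']]|[U [oU U1 U2 tU]]].
    apply: IH => //; apply: leq_trans wn; rewrite /size_of ltn_add2l.
    apply/proper_card/properP; split=> //; exists e; rewrite !inE ?we' ?eqxx //.
    by rewrite gt_eqF.
  apply: (combination_contract IH _ fP oU U1 U2 tU).
  by apply: leq_trans wn; rewrite leq_add2l subset_leq_card.
have [eps [eps0 c1]] := go d de1 dw d0.
have [||| del [del0 c2]] := go (fun e => - d e).
- by rewrite oppr_eq0.
- by move=> e; rewrite oppr_eq0 => /dw.
- by move=> v; rewrite sumrN d0 oppr0.
have s0 : 0 < eps + del by rewrite addr_gt0.
(* [w] lies between [w + eps d] and [w - del d]; these coefficients cancel [d]. *)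
apply: (combinationD _ _ c1 c2 (a := del / (eps + del)) (b := eps / (eps + del))).
- by rewrite divr_ge0 // ltW.
- by rewrite divr_ge0 // ltW.
by move=> e; field; rewrite gt_eqF.
Qed.

Lemma sum_combination (I : finType) (lam : I -> R) (M : I -> {set E})
    (w c : E -> R) (C : {set E}) :
  (forall e, w e = \sum_(i | e \in M i) lam i) ->
  \sum_(e in C) c e * w e = \sum_i lam i * \sum_(e in M i :&: C) c e.
Proof.
move=> wE; under eq_bigr do rewrite wE mulr_sumr.
rewrite (exchange_big_dep xpredT) //=; apply: eq_bigr => i _.
rewrite mulr_sumr; apply: eq_big => [e|e _]; first by rewrite inE andbC.
by rewrite mulrC.
Qed.

Lemma sum_combination_card (I : finType) (lam : I -> R) (M : I -> {set E})
    (w : E -> R) (C : {set E}) :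
  (forall e, w e = \sum_(i | e \in M i) lam i) ->
  \sum_(e in C) w e = \sum_i lam i * #|M i :&: C|%:R.
Proof.
move=> wE; have := sum_combination (fun=> 1) C wE.
under eq_bigr do rewrite mul1r; move=> ->.
by apply: eq_bigr => i _; rewrite sumr_const.
Qed.

(** The coefficients sum to 1, so some 1-factor of positive coefficient reaches the average on [C].
    Every 1-factor meets an odd cut at least once, so where the average is 1 each such 1-factor
    meets it exactly once. *)
Lemma exists_perfect_tight (V : finType) (t h : E -> V) (w : E -> R)
    (C : {set E}) :
  (0 < #|V|)%N -> fractional_factor t h w ->
  exists M : {set E}, [/\ perfect t h M, \sum_(e in C) w e <= #|M :&: C|%:R
    & forall S : {set V}, odd #|S| -> \sum_(e in ecut t h S) w e = 1 ->
        #|M :&: ecut t h S| = 1%N].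
Proof.
move=> /card_gt0P[v0 _] wP; have [_ _ w1 _] := wP.
have [I [lam [M [l0 lP wE]]]] := fractional_factor_combination wP.
have star (S : {set V}) : odd #|S| ->
    forall i, 0 < lam i -> (0 < #|M i :&: ecut t h S|)%N.
  by move=> oS i /lP pM; apply: odd_gt0; rewrite odd_perfect.
have suml : \sum_i lam i = 1.
  rewrite -(w1 v0) (sum_combination_card _ wE); apply: eq_bigr => i _.
  case: (ltrP 0 (lam i)) => [/lP -> |li]; first by rewrite mulr1.
  by have -> : lam i = 0; [apply/le_anti; rewrite li l0 | rewrite mul0r].
have [i /andP[li iC]] :
    exists i, (0 < lam i) && (\sum_(e in C) w e <= #|M i :&: C|%:R).
  apply/existsP; apply: contraT => /existsPn no.
  set s := \sum_(e in C) w e in no *.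
  have le i : lam i * #|M i :&: C|%:R <= lam i * s.
    case: (ltrP 0 (lam i)) => li.
      by have := no i; rewrite li /= -ltNge => /ltW; rewrite ler_pM2l.
    by have -> : lam i = 0; [apply/le_anti; rewrite li l0 | rewrite !mul0r].
  have : \sum_i (lam i * s - lam i * #|M i :&: C|%:R) = 0.
    rewrite big_split /= sumrN -mulr_suml suml mul1r -(sum_combination_card _ wE).
    by rewrite subrr.
  have ge0 i : 0 <= lam i * s - lam i * #|M i :&: C|%:R by rewrite subr_ge0.
  move/(psumr_eq0P (fun i _ => ge0 i)) => eq0.
  have [i li] : exists i, 0 < lam i.
    apply/existsP; apply: contraT => /existsPn no0.
    move/eqP: suml; rewrite big1 ?(eq_sym 0) ?oner_eq0 // => i _.
    by apply/le_anti; rewrite l0 andbT leNgt no0.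
  have := no i; rewrite li /= -ltNge; have := eq0 i isT; rewrite -mulrBr => /eqP.
  by rewrite mulf_eq0 gt_eqF //= subr_eq0 => /eqP ->; rewrite ltxx.
exists (M i); split=> // [|S oS tS]; first exact: lP.
have : \sum_j lam j * (#|M j :&: ecut t h S|%:R - 1) = 0.
  under eq_bigr do rewrite mulrBr mulr1.
  by rewrite big_split /= sumrN suml -(sum_combination_card _ wE) tS subrr.
have ge0 j : 0 <= lam j * (#|M j :&: ecut t h S|%:R - 1).
  case: (ltrP 0 (lam j)) => lj.
    by rewrite mulr_ge0 // subr_ge0 ler1n star.
  by have -> : lam j = 0; [apply/le_anti; rewrite lj l0 | rewrite mul0r].
move/(psumr_eq0P (fun j _ => ge0 j))/(_ i isT)/eqP.
by rewrite mulf_eq0 gt_eqF //= subr_eq0 pnatr_eq1 => /eqP.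
Qed.

End MatchingPolytope.

(** * Choosing the 1-factors one at a time *)

Section Covering.
Variables (R : realFieldType) (V E : finType) (t h : E -> V) (r a b : nat).
Hypothesis V_nonempty : (0 < #|V|)%N.
Hypothesis loopless : forall e, t e != h e.
Hypothesis degree : forall v, #|ecut t h [set v]| = r.
Hypothesis odd_cut : forall S : {set V}, odd #|S| -> (r <= #|ecut t h S|)%N.
Hypothesis r_ge3 : (3 <= r)%N.
Hypothesis ra : (r - 1 <= 2 * a)%N.
Hypothesis b_gt0 : (0 < b)%N.

Implicit Types (Ms : seq {set E}) (S : {set V}).

Definition multiplicity Ms e := count (fun M : {set E} => e \in M) Ms.
Definition load Ms (C : {set E}) := (\sum_(M <- Ms) #|M :&: C|)%N.

Lemma sum_multiplicity Ms (C : {set E}) :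
  (\sum_(e in C) multiplicity Ms e)%N = load Ms C.
Proof.
elim: Ms => [|M Ms IH]; first by rewrite /load big_nil big1.
by rewrite big_split IH /load big_cons /= setIC sum_in_setI.
Qed.

Lemma odd_ecut_regular S : odd #|ecut t h S| = odd r && odd #|S|.
Proof.
rewrite -[ecut t h S]setTI odd_ecut (eq_bigr (fun=> r)) => [|v _].
  by rewrite sum_nat_const oddM andbC.
by rewrite setTI degree.
Qed.

Lemma odd_load Ms S : (forall M, M \in Ms -> perfect t h M) -> odd #|S| ->
  odd (load Ms (ecut t h S)) = odd (size Ms).
Proof.
move=> MsP oS; elim: Ms MsP => [|M Ms IH] MsP; first by rewrite /load big_nil.
rewrite /load big_cons oddD odd_perfect ?oS => [|]; last first.
  by apply: MsP; rewrite mem_head.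
by rewrite IH // => N NMs; apply: MsP; rewrite inE NMs orbT.
Qed.

Lemma size_le_load Ms S : (forall M, M \in Ms -> perfect t h M) -> odd #|S| ->
  (size Ms <= load Ms (ecut t h S))%N.
Proof.
move=> MsP oS; rewrite -sum1_size /load big_seq [leqRHS]big_seq.
by apply: leq_sum => M /MsP pM; apply: odd_gt0; rewrite odd_perfect.
Qed.

(* With [A = a k + b]: the weights [(A - multiplicity) / (r A - k)] satisfy   *)
(* the odd cut inequalities.                                                  *)
Definition balanced k Ms := forall S, odd #|S| ->
  (load Ms (ecut t h S) + r * (a * k + b) <= #|ecut t h S| * (a * k + b) + k)%N.

(** Let the cut have size r + 2q. If it is tight, the new 1-factor adds 1 to both sides. Otherwise q
    > 0, parity gives a slack of 2, the new 1-factor uses at most r + 2q edges, and r + 2q - 3 <=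
    q(r - 1) <= 2qa since r >= 3. *)
Lemma balanced_cons k Ms M :
  size Ms = k -> (forall N, N \in Ms -> perfect t h N) -> perfect t h M ->
  balanced k Ms ->
  (forall S, odd #|S| ->
     (load Ms (ecut t h S) + r * (a * k + b) = #|ecut t h S| * (a * k + b) + k)%N ->
     #|M :&: ecut t h S| = 1%N) ->
  balanced k.+1 (M :: Ms).
Proof.
move=> szMs MsP pM bal tight S oS.
have rC := odd_cut oS; have := odd_ecut_regular S; rewrite oS andbT => oC.
have oL := odd_load MsP oS; have kL := size_le_load MsP oS.
have MC : (#|M :&: ecut t h S| <= #|ecut t h S|)%N.
  by rewrite subset_leq_card // subsetIr.
have := bal S oS; have := tight S oS; rewrite /load big_cons -/(load Ms _).
move: (load Ms _) (#|ecut t h S|) (#|M :&: _|) oL kL oC rC MC.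
rewrite szMs => L c m oL kL oC rC mc tS LS.
have [q cq] : exists q, c = (r + 2 * q)%N.
  exists ((c - r)./2)%N; rewrite mul2n halfK oddB // oC addbb subn0; lia.
subst c; set A := (a * k + b)%N in tS LS *.
have LS' : (L <= 2 * q * A + k)%N by lia.
have -> : (a * k.+1 + b = A + a)%N by rewrite /A; lia.
have oA : odd (2 * q * A + k) = odd k by rewrite oddD -mulnA oddM.
case: (eqVneq L (2 * q * A + k)%N) => [Leq|Lneq].
  rewrite tS; last by rewrite Leq; lia.
  by rewrite Leq; nia.
have LS2 : (L + 2 <= 2 * q * A + k)%N by lia.
have q0 : (0 < q)%N by lia.
have qa : (q * (r - 1) <= q * (2 * a))%N by rewrite leq_mul2l ra orbT.
have rq : (r - 1 + 2 * (q - 1) <= q * (r - 1))%N by nia.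
have -> : ((r + 2 * q) * (A + a) = r * (A + a) + 2 * q * A + q * (2 * a))%N by lia.
move: (2 * q * A)%N (q * (2 * a))%N (q * (r - 1))%N (r * (A + a))%N LS2 qa rq.
lia.
Qed.

Lemma exists_covering_factors k : exists Ms,
  [/\ size Ms = k, forall M, M \in Ms -> perfect t h M, balanced k Ms
    & #|[set e | multiplicity Ms e == 0%N]|%:R <=
      #|E|%:R * \prod_(0 <= i < k)
        (1 - (a * i + b)%:R / (r%:R * (a * i + b)%:R - i%:R)) :> R].
Proof.
elim: k => [|k [Ms [szMs MsP bal Ubound]]].
  exists [::]; split=> // [S oS|]; last first.
    by rewrite big_nil mulr1 ler_nat max_card.
  by rewrite /load big_nil add0n addn0 leq_mul2r odd_cut ?orbT.
have [A defA] : exists A, A = (a * k + b)%N by exists (a * k + b)%N.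
pose B : R := r%:R * A%:R - k%:R.
have kA : (k < A)%N by rewrite defA; nia.
have AB : A%:R <= B by rewrite /B lerBrDr -natrM -natrD ler_nat; nia.
have B0 : 0 < B by apply: lt_le_trans AB; rewrite ltr0n; lia.
pose w e : R := (A%:R - (multiplicity Ms e)%:R) / B.
have sumw (C : {set E}) :
    \sum_(e in C) w e = (#|C|%:R * A%:R - (load Ms C)%:R) / B.
  rewrite -mulr_suml sumrB sumr_const -sum_multiplicity natr_sum.
  by rewrite -[A%:R *+ _]mulr_natl.
have wP : fractional_factor t h w.
  split=> [e|e the|v|S oS].
  - apply: divr_ge0; last exact: ltW.
    by rewrite subr_ge0 ler_nat (leq_trans (count_size _ _)) // szMs ltnW.
  - by have := loopless e; rewrite the eqxx.
  - rewrite sumw degree /load big_seq (eq_bigr (fun=> 1%N)) => [|M MMs]; last first.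
      exact: MsP.
    by rewrite -big_seq sum1_size szMs divff // gt_eqF.
  rewrite sumw ler_pdivlMr // mul1r /B lerBlDr addrAC lerBrDr -!natrM -!natrD.
  by rewrite ler_nat addnC defA; apply: bal.
set U := [set e | multiplicity Ms e == 0%N] in Ubound.
have [M [pM MU tight]] := exists_perfect_tight U V_nonempty wP.
exists (M :: Ms); split=> [|N||].
- by rewrite /= szMs.
- by rewrite inE => /predU1P[->//|/MsP].
- apply: balanced_cons => // S oS tS; apply: tight => //.
  rewrite sumw; have : B != 0 by rewrite gt_eqF.
  move: tS; rewrite -defA => /(congr1 (fun n => n%:R : R)).
  rewrite !natrD !natrM => tS BN.
  by rewrite (_ : _ - _ = B) ?divff // /B; lra.
rewrite big_nat_recr //= mulrA -defA -/B.
(* Uncovered edges all have weight [A / B], so [M] covers at least that fraction of them. *)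
have sU : \sum_(e in U) w e = #|U|%:R * (A%:R / B).
  rewrite sumw -sum_multiplicity big1 ?subr0 ?mulrA // => e.
  by rewrite inE => /eqP.
apply: le_trans (_ : #|U|%:R * (1 - A%:R / B) <= _).
  have -> : [set e | multiplicity (M :: Ms) e == 0%N] = U :\: M.
    by apply/setP => e; rewrite !inE /= addn_eq0 eqb0.
  rewrite cardsD natrB ?subset_leq_card ?subsetIl //.
  by rewrite mulrBr mulr1 lerD2l lerN2 -sU setIC.
by rewrite ler_wpM2r // subr_ge0 ler_pdivrMr // mul1r.
Qed.

End Covering.

(** * Transfer to multigraphs *)

Section Multigraph.
Variable G : multigraph.

(** An arbitrary orientation: two end maps, unlike [ends], still describe a graph once contraction
    creates loops. *)
Lemma ends_pair : exists f : edge G -> vertex G * vertex G,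
  forall e, (f e).1 != (f e).2 /\ ends e = [set (f e).1; (f e).2].
Proof.
apply: (fin_all_exists (P := fun e (p : vertex G * vertex G) =>
  p.1 != p.2 /\ ends e = [set p.1; p.2])) => e.
have /eqP/cards2P[x [y [xy eE]]] := card_ends e.
by exists (x, y).
Qed.

Section Orientation.
Variable f : edge G -> vertex G * vertex G.
Hypothesis fP : forall e, (f e).1 != (f e).2 /\ ends e = [set (f e).1; (f e).2].
Let t e := (f e).1.
Let h e := (f e).2.

Lemma cut_ecut S : cut S = ecut t h S.
Proof.
apply/setP => e; rewrite !inE; have [th ->] := fP e.
rewrite setIUl -sum1_card.
rewrite (_ : _ :|: _ = [set v in [set t e; h e] | v \in S]); last first.
  apply/setP => v; rewrite !inE /t /h.
  by do 2!case: eqP => //= _; rewrite ?orbF ?andbF ?orbb.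
rewrite (eq_bigl (fun v => (v \in [set t e; h e]) && (v \in S))); last first.
  by move=> v; rewrite !inE.
by rewrite big_mkcondr big_setU1 ?inE //= big_set1; do 2!case: (_ \in S).
Qed.

Lemma incident_ecut (M : {set edge G}) v :
  [set e in M | v \in ends e] = M :&: ecut t h [set v].
Proof.
apply/setP => e; rewrite !inE; case: (e \in M) => //=.
have [th ->] := fP e; rewrite !inE ![v == _]eq_sym /t /h.
by case: eqP => [<-|//]; rewrite eq_sym (negPf th).
Qed.

End Orientation.

Lemma degree_ecut r f (v : vertex G) :
  (forall e, (f e).1 != (f e).2 /\ ends e = [set (f e).1; (f e).2]) ->
  regular G r -> #|ecut (fun e => (f e).1) (fun e => (f e).2) [set v]| = r.
Proof.
move=> fP rG; rewrite -[ecut _ _ _]setTI -incident_ecut // -(rG v).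
by congr #|pred_of_set _|; apply/setP => e; rewrite !inE.
Qed.

Lemma odd_cut_regular r (S : {set vertex G}) :
  regular G r -> odd #|cut S| = odd r && odd #|S|.
Proof.
move=> rG; have [f fP] := ends_pair; rewrite (cut_ecut fP).
by apply: odd_ecut_regular => v; apply: degree_ecut.
Qed.

Lemma balanced_factors (r a b k : nat) :
  r_graph G r -> (3 <= r)%N -> (r - 1 <= 2 * a)%N -> (0 < b)%N ->
  exists M : 'I_k -> {set edge G},
    [/\ forall i, one_factor (M i),
        (#|\bigcup_(i < k) M i|%:R / #|edge G|%:R : rat) >=
          1 - \prod_(0 <= i < k)
                (1 - (a * i + b)%:R / (r%:R * (a * i + b)%:R - i%:R)),
        forall S : {set vertex G}, odd #|S| -> (k <= \sum_(i < k) #|M i :&: cut S|)%N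
      & forall S : {set vertex G}, odd #|S| ->
          (\sum_(i < k) #|M i :&: cut S| + r * (a * k + b)
             <= #|cut S| * (a * k + b) + k)%N].
Proof.
move=> [rG oG] r3 ra b0; have [f fP] := ends_pair.
set t := fun e => (f e).1; set h := fun e => (f e).2.
have deg v : #|ecut t h [set v]| = r by apply: degree_ecut.
have cutE S : cut S = ecut t h S := cut_ecut fP S.
have oC (S : {set vertex G}) : odd #|S| -> (r <= #|ecut t h S|)%N.
  by rewrite -cutE; apply: oG.
have loopless e : t e != h e by have [] := fP e.
have [Ms [szMs MsP bal Ub]] :=
  exists_covering_factors rat (vertex_nonempty G) loopless deg oC r3 ra b0 k.
have loadE C : (\sum_(i < k) #|nth set0 Ms i :&: C|)%N = load Ms C.
  by rewrite /load (big_nth set0) szMs big_mkord.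
exists (fun i : 'I_k => nth set0 Ms i); split.
- by move=> i v; rewrite (incident_ecut fP); apply: MsP; rewrite mem_nth ?szMs.
- have E0 : (0 < #|edge G|)%N.
    have /card_gt0P[v _] := vertex_nonempty G.
    apply: leq_trans (max_card (mem (ecut t h [set v]))); rewrite deg; lia.
  rewrite ler_pdivlMr ?ltr0n //.
  have -> : \bigcup_(i < k) nth set0 Ms i = ~: [set e | multiplicity Ms e == 0%N].
    apply/setP => e; rewrite !inE -lt0n -has_count; apply/bigcupP/hasP.
      by move=> [i _ ei]; exists (nth set0 Ms i); rewrite ?mem_nth ?szMs.
    move=> [M /(nthP set0)[i]]; rewrite szMs => ik <- ei.
    by exists (Ordinal ik).
  rewrite cardsCs setCK natrB ?max_card // mulrBl mul1r lerD2l lerN2.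
  by rewrite mulrC.
- by move=> S oS; rewrite cutE loadE -{1}szMs; apply: size_le_load.
by move=> S oS; rewrite cutE loadE; apply: bal.
Qed.

End Multigraph.

Theorem theorem3p3 (r : nat) (hr : (3 <= r)%N) (G : multigraph)
    (hG : r_graph G r) :
  (~~ odd r -> (4 <= r)%N -> forall k : nat, (0 < k)%N ->
    exists M : 'I_k -> {set edge G},
      [/\ forall i, one_factor (M i),
          (#|\bigcup_(i < k) M i|%:R / #|edge G|%:R : rat) >=
            1 - \prod_(1 <= i < k.+1)
                  (((r%:R ^+ 2 - 3 * r%:R + 1) * i%:R
                      - (r%:R ^+ 2 - 5 * r%:R + 3))
                   / ((r%:R ^+ 2 - 2 * r%:R - 1) * i%:R
                      - (r%:R ^+ 2 - 4 * r%:R - 1)))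
        & forall C : {set edge G}, edge_cut C -> #|C| = r.+1 ->
            (\sum_(i < k) #|M i :&: C| <= (r - 1) * k + 2)%N])
  /\
  (odd r -> (3 <= r)%N -> forall k : nat, (0 < k)%N ->
    exists M : 'I_k -> {set edge G},
      [/\ forall i, one_factor (M i),
          (#|\bigcup_(i < k) M i|%:R / #|edge G|%:R : rat) >=
            1 - \prod_(1 <= i < k.+1)
                  (((r%:R ^+ 2 - 2 * r%:R - 1) * i%:R
                      - (r%:R ^+ 2 - 4 * r%:R + 1))
                   / ((r%:R ^+ 2 - r%:R - 2) * i%:R
                      - (r%:R ^+ 2 - 3 * r%:R - 2))),
          forall C : {set edge G}, edge_cut C -> #|C| = r ->
            (\sum_(i < k) #|M i :&: C|)%N = k
        & forall D : {set edge G}, edge_cut D -> #|D| = r.+2 ->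
            (\sum_(i < k) #|M i :&: D| <= r * k + 2)%N]).
Proof.
have [rG _] := hG.
split=> [er r4 k _|or r3 k _].
- have [|M [M1 Mcov _ _]] := @balanced_factors G r (r - 2) 2 k hG hr _ isT.
    by lia.
  exists M; split=> // [|C [S ->] cS]; last first.
    (* With r even every cut is even, while r + 1 is odd. *)
    by have := odd_cut_regular S rG; rewrite cS /= er (negPf er).
  (* Factor i + 1 of the stated product is 1 - A / (rA - i) with A = (r - 2)i + 2. *)
  rewrite big_add1 /=; apply: le_trans Mcov; rewrite lerD2l lerN2.
  rewrite le_eqVlt; apply/orP; left; apply/eqP/eq_bigr => i _.
  have r2 : (r - 2)%:R = r%:R - 2 :> rat by rewrite natrB //; lia.
  rewrite natrD natrM r2 -[i.+1]addn1 natrD.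
  have r4' : 4 <= r%:R :> rat by rewrite ler_nat.
  have i0 : 0 <= i%:R :> rat by [].
  set x : rat := r%:R in r4' *; set y : rat := i%:R in i0 *.
  have x1 : 0 <= x * (x - 2) - 1.
    by rewrite subr_ge0 -[1]mulr1 ler_pM //; lra.
  have den : 0 < x * ((x - 2) * y + 2) - y.
    by have := mulr_ge0 x1 i0; lra.
  have -> : (x ^+ 2 - 2 * x - 1) * (y + 1) - (x ^+ 2 - 4 * x - 1) =
            x * ((x - 2) * y + 2) - y by ring.
  rewrite -[X in X - _](@divff _ (x * ((x - 2) * y + 2) - y)) ?gt_eqF //.
  by rewrite -mulrBl; congr (_ / _); ring.
pose a := ((r - 1)./2)%N.
have a2 : (2 * a = r - 1)%N by rewrite /a mul2n halfK oddB ?or //; lia.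
have [|M [M1 Mcov Mge Mle]] := @balanced_factors G r a 1 k hG hr _ isT.
  by rewrite a2.
have oddS (S : {set vertex G}) : odd #|cut S| -> odd #|S|.
  by rewrite (odd_cut_regular S rG) => /andP[].
exists M; split=> // [|C [S ->] cS|D [S ->] cS].
- rewrite big_add1 /=; apply: le_trans Mcov; rewrite lerD2l lerN2.
  rewrite le_eqVlt; apply/orP; left; apply/eqP/eq_bigr => i _.
  have ra : r%:R = 2 * a%:R + 1 :> rat.
    by rewrite -natrM a2 natr1 -subSn ?subn1 //; lia.
  rewrite natrD natrM -[i.+1]addn1 natrD ra.
  have a1 : 1 <= a%:R :> rat by rewrite ler1n; lia.
  have i0 : 0 <= i%:R :> rat by [].
  set x : rat := a%:R in a1 *; set y : rat := i%:R in i0 *.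
  have den : (2 * x + 1) * (x * y + 1) - y > 0.
    have x1 : 0 <= (2 * x + 1) * x - 1.
      by rewrite subr_ge0 -[1]mulr1 ler_pM //; lra.
    by have := mulr_ge0 x1 i0; lra.
  (* Numerator and denominator in the statement are both twice those obtained from A = ai + 1. *)
  have -> : ((2 * x + 1) ^+ 2 - (2 * x + 1) - 2) * (y + 1) -
      ((2 * x + 1) ^+ 2 - 3 * (2 * x + 1) - 2) =
      2 * ((2 * x + 1) * (x * y + 1) - y) by ring.
  rewrite -[X in X - _](@divff _ ((2 * x + 1) * (x * y + 1) - y)) ?gt_eqF //.
  have den0 : (2 * x + 1) * (x * y + 1) - y != 0 by rewrite gt_eqF.
  rewrite -mulrBl; apply/eqP; rewrite eqr_div ?mulf_neq0 //.
  by apply/eqP; ring.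
- have oS : odd #|S| by apply: oddS; rewrite cS.
  have := Mle S oS; have := Mge S oS; rewrite cS; lia.
(* Size r + 2 means q = 1: the bound is 2(ak + 1) + k with 2a = r - 1. *)
have oS : odd #|S| by apply: oddS; rewrite cS /= negbK.
have := Mle S oS; rewrite cS; nia.
Qed.
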